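(* Let $N\ge 2$ be an integer, let $\lambda_1,\ldots,\lambda_N$ be distinct real numbers, and for each $n\in\{1,\ldots,N\}$ define $\delta_n:=\min\{|\lambda_n-\lambda_m| : 1\le m\le N,\ m\neq n\}$. Then for all $a_1,\ldots,a_N\in\mathbb{C}$, $$\left|\sum_{\substack{m,n=1\\ m\neq n}}^{N}\frac{a_m\overline{a_n}}{\lambda_m-\lambda_n}\right|\ \le\ 2\pi\sum_{n=1}^{N}\frac{|a_n|^2}{\delta_n}.$$ *)

(* Defs.v *)
From HB Require Import structures.
From mathcomp Require Import all_boot all_order all_algebra.
From mathcomp Require Import all_classical all_reals all_analysis.
From mathcomp Require Import complex.

Set Implicit Arguments.
Unset Strict Implicit.
Unset Printing Implicit Defensive.
Import Order.TTheory GRing.Theory Num.Theory.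
Local Open Scope ring_scope.

(* The minimum is taken in \bar R, whose +oo is the neutral element for mine;
   for 2 <= N the index set is nonempty, and delta_le and delta_attained show
   that fine loses nothing: delta lambda n is the minimum distance in R. *)
Definition delta (R : realType) (N : nat) (lambda : 'I_N -> R) (n : 'I_N) : R :=
  fine (\big[mine/+oo%E]_(m < N | m != n) `|lambda n - lambda m|%:E).

Lemma delta_le (R : realType) (N : nat) (lambda : 'I_N -> R) (n m : 'I_N) :
  m != n -> delta lambda n <= `|lambda n - lambda m|.
Proof.
move=> hm; rewrite /delta -lee_fin.
have [k hk e] := eq_bigmin (x := +oo%E) m (fun m => m != n)
  (fun m => `|lambda n - lambda m|%:E) hm (fun _ _ => leey _).
by rewrite {1}e /= -e; exact: bigmin_le_cond.
Qed.

Lemma delta_attained (R : realType) (N : nat) (lambda : 'I_N -> R) (n : 'I_N) :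
  (2 <= N)%N -> exists2 m, m != n & delta lambda n = `|lambda n - lambda m|.
Proof.
move=> hN.
have [m0 hm0] : exists m, m != n.
  have h0 : (0 < N)%N by exact: ltnW.
  have [->|h] := eqVneq n (Ordinal h0); first by exists (Ordinal hN).
  by exists (Ordinal h0); rewrite eq_sym.
have [m hm e] := eq_bigmin (x := +oo%E) m0 (fun m => m != n)
  (fun m => `|lambda n - lambda m|%:E) hm0 (fun _ _ => leey _).
by exists m => //; rewrite /delta e.
Qed.

(* Main.v *)
Require Import Defs.
From HB Require Import structures.
From mathcomp Require Import all_boot all_order all_algebra.
From mathcomp Require Import all_classical all_reals all_analysis.
From mathcomp Require Import complex spectral.
From mathcomp Require Import ring lra.

(** Following Montgomery and Vaughan, put s_n = sqrt (delta_n) and consider the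
    skew-symmetric matrix A with entries s_m s_n / (lambda_m - lambda_n); by the
    spectral theorem it suffices to bound its eigenvalues by 2 pi in modulus.
    Let u be an eigenvector for c. Expanding |u A|^2 and splitting
    1/((x_m - x_n)(x_k - x_n)) into partial fractions, the terms involving the
    sums T_m = \sum_n s_n^2 / (lambda_m - lambda_n) cancel because c is purely
    imaginary, leaving only nonnegative kernels decaying like
    (lambda_m - lambda_k)^-2.  As the intervals of length delta_n around the
    lambda_n are disjoint, \sum_n delta_n / (lambda_m - lambda_n)^2 is at most
    4 / delta_m, which bounds the diagonal part by 4 |u|^2.  The remaining form
    Q (called [wform]) satisfies the self-improving estimate
    Q^2 <= |u|^2 (4 |u|^2 + 16 Q), so that Q <= (65/4) |u|^2.  Altogether
    |c|^2 <= 4 + 2 * 65/4 = 73/2 <= (2 pi)^2. *)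

Import Order.TTheory GRing.Theory Num.Theory.
Import Normc.
Import numFieldNormedType.Exports.
Set Implicit Arguments.
Unset Strict Implicit.
Unset Printing Implicit Defensive.
Local Open Scope ring_scope.
Local Open Scope sesquilinear_scope.
Local Open Scope complex_scope.

(** * Sums over non-overlapping intervals *)

(** Each term is at most the integral of 1/x^2 over the interval of length [w n] centred at [c n].
    These intervals do not overlap and lie in [L, oo), where the whole integral is 1/L. *)
Lemma sum_inv_sqr_above (R : realFieldType) (I : finType) (c w : I -> R)
    (A : {set I}) (L : R) :
    0 < L ->
    {in A, forall n, 0 < w n} ->
    {in A, forall n, L <= c n - w n / 2} ->
    {in A &, forall m n, m != n -> (w m + w n) / 2 <= `|c m - c n|} ->
  \sum_(n in A) w n / c n ^+ 2 <= L^-1.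
Proof.
(* Remove the leftmost interval and let L jump to its right endpoint. *)
elim: {A}_.+1 {-2}A (ltnSn #|A|) L => // N IH A leA L L0 w0 hL hd.
have [->|[n0 n0A]] := set_0Vmem A; first by rewrite big_set0 invr_ge0 ltW.
have [n /= nA nmin] := Order.TotalTheory.arg_minP c n0A.
have {}nA : n \in A by [].
rewrite (big_setD1 n) //=.
have wn := w0 _ nA; have Ln := hL _ nA.
have cw : 0 < c n + w n / 2 by lra.
have cw' : 0 < c n - w n / 2 by lra.
have c0 : 0 < c n by lra.
have rest : \sum_(i in A :\ n) w i / c i ^+ 2 <= (c n + w n / 2)^-1.
  apply: IH => //.
  - by rewrite (cardsD1 n) nA in leA.
  - by move=> i /setD1P[_ /w0].
  - move=> i /setD1P[ni iA]; have := hd _ _ iA nA ni.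
    by rewrite ger0_norm ?subr_ge0 ?nmin //; lra.
  - by move=> i j /setD1P[_ iA] /setD1P[_ jA]; exact: hd.
apply: (@le_trans _ _ (c n - w n / 2)^-1); last by rewrite lef_pV2 ?posrE.
rewrite -lerBrDr; apply: le_trans (_ : (c n - w n / 2)^-1 - (c n + w n / 2)^-1 <= _);
  last by rewrite lerB.
have -> : (c n - w n / 2)^-1 - (c n + w n / 2)^-1
          = w n / ((c n - w n / 2) * (c n + w n / 2)).
  by field; rewrite !gt_eqF //; lra.
rewrite ler_pM2l // lef_pV2 ?posrE ?exprn_gt0 ?mulr_gt0 //.
by nra.
Qed.

(** * Weighted sums of the Cauchy kernel and the form [wform] *)

Section Separated.
Variables (R : realFieldType) (I : finType) (l s : I -> R).
Hypothesis s_gt0 : forall n, 0 < s n.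
Hypothesis sep : forall m n, m != n -> s n ^+ 2 <= `|l n - l m|.

(* On the diagonal [0^-1 = 0], so sums over all indices skip it. *)
Definition cauchyker (m n : I) : R := (l m - l n)^-1.
Local Notation K := cauchyker.

Let s_ge0 n : 0 <= s n. Proof. exact: ltW. Qed.

Lemma cauchyker_diag n : K n n = 0.
Proof. by rewrite /cauchyker subrr invr0. Qed.

Lemma cauchyker_anti m n : K n m = - K m n.
Proof. by rewrite /cauchyker -invrN opprB. Qed.

Lemma sep_sub_neq0 m n : m != n -> l m - l n != 0.
Proof.
move=> mn; rewrite -normr_gt0; apply: lt_le_trans (@sep n m _).
  by rewrite exprn_gt0.
by rewrite eq_sym.
Qed.

(** Each side of [l m] contributes at most 2 / s_m^2. A distance of at least both s_m^2 and s_n^2 is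
    at least their mean, so the intervals of length s_n^2 around the [l n] do not overlap and stay
    at distance s_m^2 / 2 from [l m]. *)
Lemma sum_sqr_cauchyker m : \sum_n s n ^+ 2 * K m n ^+ 2 <= 4 / s m ^+ 2.
Proof.
have sm := s_gt0 m.
(* The sign [e] selects the side of [l m]. *)
have half (e : R) : e ^+ 2 = 1 ->
  \sum_(n in [set n | 0 < e * (l n - l m)]) s n ^+ 2 / (e * (l n - l m)) ^+ 2
    <= (s m ^+ 2 / 2)^-1.
  move=> e2; have ne : `|e| = 1.
    by apply/eqP; rewrite -sqrp_eq1 // -normrX e2 normr1.
  apply: (@sum_inv_sqr_above _ _ (fun n => e * (l n - l m)) (fun n => s n ^+ 2)).
  - by rewrite divr_gt0 ?exprn_gt0.
  - by move=> n _; rewrite exprn_gt0.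
  - move=> n; rewrite inE => en.
    have nm : n != m by apply: contraTneq en => ->; rewrite subrr mulr0 ltxx.
    have := sep nm; have := @sep m n; rewrite eq_sym => /(_ nm).
    rewrite [`|l m - l n|]distrC.
    have -> : `|l n - l m| = e * (l n - l m).
      by rewrite -[RHS]gtr0_norm // normrM ne mul1r.
    lra.
  - move=> n k _ _ nk; rewrite -mulrBr normrM ne mul1r opprB addrA subrK.
    have := sep nk; have := @sep k n; rewrite eq_sym => /(_ nk).
    by rewrite [`|l k - l n|]distrC; lra.
have -> : 4 / s m ^+ 2 = (s m ^+ 2 / 2)^-1 + (s m ^+ 2 / 2)^-1.
  by field; rewrite gt_eqF.
have := lerD (half 1 (expr1n _ _)) (half (-1) _); rewrite sqrrN expr1n => /(_ erefl).
apply: le_trans.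
rewrite (bigID (fun n => l m < l n)) /= lerD //.
  rewrite le_eqVlt; apply/orP; left; apply/eqP; apply: eq_big => n.
    by rewrite inE mul1r subr_gt0.
  by move=> _; rewrite /cauchyker mul1r -[l n - l m]opprB sqrrN exprVn.
(* The indices on neither side have [l n = l m], and there the kernel is 0. *)
rewrite (bigID (fun n => l n < l m)) /= [X in _ + X]big1 ?addr0; last first.
  move=> n; rewrite -!leNgt => /andP[h1 h2].
  by rewrite /cauchyker (le_anti (introT andP (conj h1 h2))) subrr invr0 expr0n /= mulr0.
rewrite le_eqVlt; apply/orP; left; apply/eqP; apply: eq_big => n.
  rewrite inE mulN1r opprB subr_gt0.
  by apply/andP/idP => [[]//|h]; rewrite -leNgt ltW.
by move=> _; rewrite /cauchyker mulN1r opprB exprVn.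
Qed.

Lemma cauchykerM m n k : m != n -> k != m -> k != n ->
  K m k * K n k = K n m * (K m k - K n k).
Proof.
move=> mn km kn; rewrite /cauchyker; have := sep_sub_neq0 mn.
have := sep_sub_neq0 km; have := sep_sub_neq0 kn => h1 h2 h3.
have h4 : l m - l k != 0 by rewrite -opprB oppr_eq0.
have h5 : l n - l k != 0 by rewrite -opprB oppr_eq0.
have h6 : l n - l m != 0 by rewrite -opprB oppr_eq0.
by field; rewrite h4 h5 h6.
Qed.

(** Partial fractions followed by (a - b)^2 <= 2 (a^2 + b^2); for k = m or k = n the left side is
    0. *)
Lemma sqr_cauchykerM_le m n k : m != n ->
  K m k ^+ 2 * K n k ^+ 2 <= 2 * K m n ^+ 2 * (K m k ^+ 2 + K n k ^+ 2).
Proof.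
move=> mn.
have rhs_ge0 : 0 <= 2 * K m n ^+ 2 * (K m k ^+ 2 + K n k ^+ 2).
  by apply: mulr_ge0; [apply: mulr_ge0 | apply: addr_ge0]; rewrite ?sqr_ge0.
have [km|km] := eqVneq k m.
  by apply: le_trans rhs_ge0; rewrite km cauchyker_diag expr0n /= mul0r.
have [kn|kn] := eqVneq k n.
  by apply: le_trans rhs_ge0; rewrite kn cauchyker_diag expr0n /= mulr0.
rewrite -exprMn cauchykerM // exprMn cauchyker_anti sqrrN -mulrA [leRHS]mulrCA.
rewrite ler_wpM2l ?sqr_ge0 //.
by have := sqr_ge0 (K m k + K n k); nra.
Qed.

(** The bound is 8 times the symmetrised coefficient of [wform]; this is what lets the estimate of
    [wform] refer back to itself. *)
Lemma sum_sqr_cauchykerM m n : m != n ->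
  s m ^+ 3 * s n ^+ 3 * \sum_k s k ^+ 2 * (K m k ^+ 2 * K n k ^+ 2) <=
  8 * K m n ^+ 2 * (s m * s n ^+ 3 + s m ^+ 3 * s n).
Proof.
move=> mn; have sm := s_gt0 m; have sn := s_gt0 n.
have -> : 8 * K m n ^+ 2 * (s m * s n ^+ 3 + s m ^+ 3 * s n) =
  s m ^+ 3 * s n ^+ 3 * (2 * K m n ^+ 2 * (4 / s m ^+ 2 + 4 / s n ^+ 2)).
  by field; rewrite !gt_eqF.
rewrite ler_wpM2l ?mulr_ge0 ?exprn_ge0 ?s_ge0 //.
apply: le_trans (_ : \sum_k s k ^+ 2 * (2 * K m n ^+ 2 * (K m k ^+ 2 + K n k ^+ 2)) <= _).
  by apply: ler_sum => k _; rewrite ler_wpM2l ?sqr_ge0 // sqr_cauchykerM_le.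
under eq_bigr do rewrite mulrCA mulrDr.
rewrite -mulr_sumr big_split /= ler_wpM2l ?(mulr_ge0 _ (sqr_ge0 _)) //.
by rewrite lerD ?sum_sqr_cauchyker.
Qed.

(** Separation bounds one factor K^2 by s_m^-4; [sum_sqr_cauchyker] sums the other. *)
Lemma sum_pow4_cauchyker m :
  s m ^+ 3 * s m ^+ 3 * \sum_k s k ^+ 2 * (K m k ^+ 2 * K m k ^+ 2) <= 4.
Proof.
have sm := s_gt0 m.
have -> : 4 = s m ^+ 3 * s m ^+ 3 * (s m ^- 4 * (4 / s m ^+ 2)) :> R.
  by field; rewrite gt_eqF.
rewrite ler_wpM2l ?mulr_ge0 ?exprn_ge0 ?s_ge0 //.
apply: le_trans (_ : \sum_k s m ^- 4 * (s k ^+ 2 * K m k ^+ 2) <= _); last first.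
  by rewrite -mulr_sumr ler_wpM2l ?invr_ge0 ?exprn_ge0 ?s_ge0 // sum_sqr_cauchyker.
apply: ler_sum => k _; rewrite mulrA mulrC ler_wpM2r ?(mulr_ge0 (sqr_ge0 _) (sqr_ge0 _)) //.
have [->|km] := eqVneq k m.
  by rewrite cauchyker_diag expr0n /= invr_ge0 exprn_ge0.
have lmk : 0 < (l m - l k) ^+ 2.
  by rewrite exprn_even_gt0 //= -opprB oppr_eq0 sep_sub_neq0.
rewrite /cauchyker exprVn lef_pV2 ?posrE // ?exprn_gt0 //.
rewrite -(real_normK (num_real (l m - l k))) (exprM _ 2 2).
by rewrite lerXn2r ?nnegrE ?sqr_ge0 ?sep //.
Qed.

(** One half of the form with coefficients s_m s_k (s_m^2 + s_k^2) K^2: exchanging m and k gives the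
    other half, of equal value. *)
Definition wform (x : I -> R) :=
  \sum_m \sum_k x m * x k * (s m ^+ 3 * s k * K m k ^+ 2).

(** The constant 65/4 is just above 8 + sqrt 68, the positive root of q^2 = 4 + 16 q. *)
Lemma wform_le x : (forall n, 0 <= x n) ->
  wform x <= 65 / 4 * \sum_n x n ^+ 2.
Proof.
move=> x0; set X := \sum_n _; set Q := wform x.
(* Q is the inner product of [x] and [y], so it is enough to bound the norm of [y]. *)
pose y k := s k * \sum_m x m * (s m ^+ 3 * K m k ^+ 2).
have QE : Q = \sum_k x k * y k.
  rewrite /Q /wform exchange_big; apply: eq_bigr => k _.
  rewrite /y !mulr_sumr; apply: eq_bigr => m _; ring.
have yE : \sum_k y k ^+ 2 = \sum_m \sum_n x m * x n *
    (s m ^+ 3 * s n ^+ 3 * \sum_k s k ^+ 2 * (K m k ^+ 2 * K n k ^+ 2)).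
  transitivity (\sum_k \sum_m \sum_n x m * x n *
    (s m ^+ 3 * s n ^+ 3 * (s k ^+ 2 * (K m k ^+ 2 * K n k ^+ 2)))).
    apply: eq_bigr => k _; rewrite /y exprMn expr2 [X in _ * X]expr2.
    rewrite big_distrlr /= mulr_sumr; apply: eq_bigr => m _.
    rewrite mulr_sumr; apply: eq_bigr => n _; ring.
  rewrite exchange_big; apply: eq_bigr => m _.
  rewrite exchange_big; apply: eq_bigr => n _.
  by rewrite -mulr_sumr -mulr_sumr.
have yle : \sum_k y k ^+ 2 <= 4 * X + 16 * Q.
  rewrite yE; apply: le_trans (_ : \sum_m \sum_n x m * x n *
    ((if m == n then 4 else 0) + 8 * K m n ^+ 2 * (s m * s n ^+ 3 + s m ^+ 3 * s n)) <= _).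
    apply: ler_sum => m _; apply: ler_sum => n _; rewrite ler_wpM2l ?mulr_ge0 //.
    have [<-|mn] := eqVneq; last by rewrite add0r sum_sqr_cauchykerM.
    by rewrite cauchyker_diag expr0n /= mulr0 mul0r addr0 sum_pow4_cauchyker.
  (* Half of 16 Q is written with its indices exchanged, to match the symmetric coefficients. *)
  have -> : 16 * Q = 8 * Q + 8 * \sum_m \sum_k x k * x m * (s k ^+ 3 * s m * K k m ^+ 2).
    rewrite [X in _ = _ + 8 * X]exchange_big -/(wform x) -/Q; ring.
  rewrite /Q /wform !mulr_sumr -!big_split /= le_eqVlt; apply/orP; left; apply/eqP.
  apply: eq_bigr => m _; rewrite !mulr_sumr -big_split /=.
  under eq_bigr do rewrite mulrDr.
  rewrite big_split /=; congr (_ + _).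
    rewrite (bigD1 m) //= eqxx big1 ?addr0; first by ring.
    by move=> n nm; rewrite eq_sym (negbTE nm) mulr0.
  by apply: eq_bigr => n _; rewrite (cauchyker_anti m n); ring.
(* The square with t = 65/4 gives 2 t Q <= t^2 X + 4 X + 16 Q. *)
have : 0 <= \sum_k (65 / 4 * x k - y k) ^+ 2.
  by apply: sumr_ge0 => k _; rewrite sqr_ge0.
have -> : \sum_k (65 / 4 * x k - y k) ^+ 2 =
  (65 / 4) ^+ 2 * X - 2 * (65 / 4) * Q + \sum_k y k ^+ 2.
  rewrite QE !mulr_sumr -sumrN -!big_split /=; apply: eq_bigr => k _; ring.
have : 0 <= X by apply: sumr_ge0 => k _; rewrite sqr_ge0.
by lra.
Qed.

(** For m != k, partial fractions need n to differ from m and k. At these two indices the left term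
    is 0, and the K^2 terms on the right compensate the first product. *)
Lemma sum_cauchykerM m k :
  \sum_n s n ^+ 2 * (K m n * K k n) =
  K k m * (\sum_n s n ^+ 2 * K m n - \sum_n s n ^+ 2 * K k n)
  + (s m ^+ 2 + s k ^+ 2) * K m k ^+ 2
  + (if m == k then \sum_n s n ^+ 2 * K m n ^+ 2 else 0).
Proof.
have [<-|mk] := eqVneq.
  by rewrite subrr cauchyker_diag mulr0 expr0n /= mulr0 !add0r.
rewrite addr0.
have -> : (s m ^+ 2 + s k ^+ 2) * K m k ^+ 2 = \sum_n s n ^+ 2 *
    ((if n == m then K m k ^+ 2 else 0) + (if n == k then K m k ^+ 2 else 0)).
  under eq_bigr do rewrite mulrDr.
  rewrite big_split /= (bigD1 m) //= eqxx big1 ?addr0; last first.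
    by move=> i /negbTE ->; rewrite mulr0.
  rewrite (bigD1 k) //= eqxx big1 ?addr0 ?mulrDl //.
  by move=> i /negbTE ->; rewrite mulr0.
rewrite -sumrB mulr_sumr -big_split /=; apply: eq_bigr => n _.
have [->|nm] := eqVneq n m.
  by rewrite cauchyker_diag (negbTE mk) (cauchyker_anti m k); ring.
have [->|nk] := eqVneq n k.
  by rewrite cauchyker_diag (cauchyker_anti m k); ring.
by rewrite cauchykerM //; ring.
Qed.

End Separated.

(** * A lower bound for pi *)

Lemma sin_le_id (R : realType) (x : R) : 0 <= x -> sin x <= x.
Proof.
rewrite le_eqVlt => /predU1P[<-|x0]; first by rewrite sin0.
have [c _] := @MVT _ sin cos 0 x x0 (fun y _ => is_derive_sin y)
  (continuous_subspaceT (@continuous_sin R)).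
by rewrite sin0 !subr0 => ->; rewrite ler_piMl ?cos_le1 ?ltW.
Qed.

(** By sin x <= x at pi/8 and the double-angle formula, pi^2 >= 64 sin^2 (pi/8) = 32 (1 - cos
    (pi/4)). *)
Lemma pi_sqr_ge (R : realType) : 73%:R / 8%:R <= pi ^+ 2 :> R.
Proof.
have p0 := pi_gt0 R.
have s8 : sin (pi / 8%:R : R) <= pi / 8%:R by rewrite sin_le_id // divr_ge0 ?ltW.
have s80 : 0 <= sin (pi / 8%:R : R) by rewrite sin_ge0_pi //; apply/andP; split; lra.
have c40 : 0 <= cos (pi / 4%:R : R) by rewrite cos_ge0_pihalf //; apply/andP; split; lra.
have h2 : cos (pi / 4%:R *+ 2 : R) = 0.
  by rewrite -[RHS]cos_pihalf; congr cos; field.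
have h4 : cos (pi / 8%:R *+ 2 : R) = cos (pi / 4%:R).
  by congr cos; field.
rewrite cos_mulr2n in h2; rewrite cos_mulr2n cos2sin2 in h4.
(* Any bound up to 1 - 73/256 = 0.71484375 suffices. *)
have c4 : cos (pi / 4%:R : R) <= 7148%:R / 10000%:R by nra.
by nra.
Qed.

(** * Quadratic forms of normal matrices *)

(** In an orthonormal eigenbasis the form is a sum of d_i |v_i|^2, with the same norm for v as for
    u. *)
Lemma normalmx_form_le (C : numClosedFieldType) (N : nat) (A : 'M[C]_N) (M : C) :
    A \is normalmx ->
    (forall (u : 'rV_N) (c : C), u != 0 -> u *m A = c *: u -> `|c| <= M) ->
  forall u : 'rV[C]_N,
    `|(u *m A *m u^t*) 0 0| <= M * \sum_i `|u 0 i| ^+ 2.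
Proof.
move=> /orthomx_spectralP; set P := spectralmx A; set d := spectral_diag A => AE hM u.
have PU : P \is unitarymx := spectral_unitarymx A.
have Pinv : invmx P = P^t* := invmx_unitary PU.
(* The rows of P are nonzero eigenvectors for the d_i. *)
have dM i : `|d 0 i| <= M.
  apply: (hM (row i P)).
    apply/eqP => Pi0; have : row i (P *m invmx P) = 0 by rewrite row_mul Pi0 mul0mx.
    rewrite mulmxV ?spectral_unit // => /rowP /(_ i) /eqP.
    by rewrite !mxE eqxx oner_eq0.
  rewrite -row_mul AE !mulmxA mulmxV ?spectral_unit // mul1mx.
  apply/rowP => j; rewrite row_mul row_diag_mx -scalemxAl -rowE.
  by rewrite !mxE.
pose v := u *m P^t*.
have sqr_sum (w : 'rV[C]_N) : (w *m w^t*) 0 0 = \sum_i `|w 0 i| ^+ 2.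
  by rewrite mxE; apply: eq_bigr => i _; rewrite !mxE normCK.
have vE : v^t* = P *m u^t*.
  by rewrite /v trmx_mul map_mxM trmxCK.
have -> : \sum_i `|u 0 i| ^+ 2 = \sum_i `|v 0 i| ^+ 2.
  by rewrite -!sqr_sum vE /v -Pinv mulmxA mulmxKV ?spectral_unit.
have -> : (u *m A *m u^t*) 0 0 = \sum_i d 0 i * `|v 0 i| ^+ 2.
  rewrite AE Pinv -!mulmxA -vE mulmxA -/v mulmxA mxE.
  apply: eq_bigr => i _; rewrite mul_mx_diag !mxE normCK; ring.
rewrite mulr_sumr; apply: le_trans (ler_norm_sum _ _ _) _.
apply: ler_sum => i _.
by rewrite normrM [`|_ ^+ 2|]ger0_norm ?exprn_ge0 // ler_wpM2r ?exprn_ge0.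
Qed.

(** * Eigenvalues of the weighted Cauchy matrix *)

Section WeightedCauchyMatrix.
Variables (R : rcfType) (N : nat) (l s : 'I_N -> R).
Hypothesis s_gt0 : forall n, 0 < s n.
Hypothesis sep : forall m n, m != n -> s n ^+ 2 <= `|l n - l m|.
Local Notation K := (cauchyker l).
Definition wcauchy m n := s m * s n * K m n.
Local Notation e := wcauchy.

Definition cauchymx : 'M[R[i]]_N :=
  \matrix_(m, n) (e m n)%:C.

Let eC m n : e n m = - e m n.
Proof. by rewrite /wcauchy cauchyker_anti; ring. Qed.

Let conj_real (x : R) : Num.conj (x%:C) = x%:C.
Proof. exact: conjc_real. Qed.

Lemma cauchymx_skew : cauchymx^t* = - cauchymx.
Proof.
by apply/matrixP => m n; rewrite !mxE conj_real -rmorphN -eC.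
Qed.

Lemma cauchymx_normal : cauchymx \is normalmx.
Proof. by apply/normalmxP; rewrite cauchymx_skew mulmxN mulNmx. Qed.

Let sum_eM m k : \sum_n e m n * e k n =
  e k m * (\sum_n s n ^+ 2 * K m n - \sum_n s n ^+ 2 * K k n)
  + (s m * s k * (s m ^+ 2 + s k ^+ 2) * K m k ^+ 2
    + (if m == k then s m ^+ 2 * \sum_n s n ^+ 2 * K m n ^+ 2 else 0)).
Proof.
transitivity (s m * s k * \sum_n s n ^+ 2 * (K m n * K k n)).
  by rewrite mulr_sumr; apply: eq_bigr => n _; rewrite /wcauchy; ring.
rewrite (sum_cauchykerM s_gt0 sep) /wcauchy; case: eqVneq => [->|_]; ring.
Qed.

Lemma cauchymx_eigen_le (u : 'rV_N) (c : R[i]) :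
  u != 0 -> u *m cauchymx = c *: u -> `|c| ^+ 2 <= (73 / 2)%:C.
Proof.
move=> u0 uc.
pose x n := normc (u 0 n).
have xE n : `|u 0 n| = (x n)%:C by [].
have x0 n : 0 <= x n by rewrite -ler0c -xE.
pose X := \sum_n x n ^+ 2.
have X0 : 0 < X.
  rewrite lt_neqAle sumr_ge0 ?andbT; last by move=> n _; rewrite exprn_ge0.
  apply: contra u0; rewrite eq_sym psumr_eq0 => [/allP h|n _]; last by rewrite exprn_ge0.
  apply/eqP/rowP => n; rewrite mxE; apply/eqP; rewrite -normr_eq0 xE.
  by have := h n (mem_index_enum _); rewrite /= sqrf_eq0 => /eqP ->.
have uuE n : u 0 n * Num.conj (u 0 n) = (x n ^+ 2)%:C.
  by rewrite -normCK xE rmorphXn.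
have row n : \sum_m u 0 m * (e m n)%:C = c * u 0 n.
  have /rowP /(_ n) := uc; rewrite !mxE => <-.
  by apply: eq_bigr => m _; rewrite mxE.
have col n : \sum_m Num.conj (u 0 m) * (e m n)%:C = Num.conj c * Num.conj (u 0 n).
  rewrite -rmorphM -row rmorph_sum; apply: eq_bigr => m _.
  by rewrite [RHS]rmorphM /= conj_real.
(* Both c X and its conjugate are sums against the real antisymmetric kernel [e], with u and its
   conjugate exchanged; they are opposite, and X > 0. *)
have cJ : c + Num.conj c = 0.
  have : (c + Num.conj c) * X%:C = 0.
    have h1 : \sum_n \sum_m u 0 m * (e m n)%:C * Num.conj (u 0 n) = c * X%:C.
      rewrite /X rmorph_sum mulr_sumr; apply: eq_bigr => n _.
      by rewrite -mulr_suml row -mulrA uuE.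
    have h2 : \sum_n \sum_m Num.conj (u 0 m) * (e m n)%:C * u 0 n = Num.conj c * X%:C.
      rewrite /X rmorph_sum mulr_sumr; apply: eq_bigr => n _.
      by rewrite -mulr_suml col -mulrA [_ * u 0 n]mulrC uuE.
    rewrite mulrDl -h1 -h2 [X in _ + X]exchange_big -big_split big1 // => n _.
    rewrite -big_split big1 // => m _ /=.
    by rewrite (eC m n) rmorphN /=; ring.
  move=> /eqP; rewrite mulf_eq0 => /orP[/eqP //|].
  by rewrite (fmorph_eq0 (real_complex R)) gt_eqF.
pose T m := \sum_n s n ^+ 2 * K m n.
pose W m k := s m * s k * (s m ^+ 2 + s k ^+ 2) * K m k ^+ 2
    + (if m == k then s m ^+ 2 * \sum_n s n ^+ 2 * K m n ^+ 2 else 0).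
have W0 m k : 0 <= W m k.
  rewrite addr_ge0 //.
    apply: mulr_ge0 (sqr_ge0 _); apply: mulr_ge0; last by rewrite addr_ge0 ?sqr_ge0.
    by rewrite mulr_ge0 // ltW.
  case: eqP => // _; rewrite mulr_ge0 ?sqr_ge0 // sumr_ge0 // => n _.
  by rewrite mulr_ge0 ?sqr_ge0.
have key : `|c| ^+ 2 * X%:C =
    \sum_m \sum_k u 0 m * Num.conj (u 0 k) * (W m k)%:C.
  transitivity (\sum_n \sum_m \sum_k u 0 m * Num.conj (u 0 k) * (e m n * e k n)%:C).
    rewrite /X rmorph_sum mulr_sumr; apply: eq_bigr => n _.
    rewrite /= -uuE normCK mulrACA -row -col big_distrlr /=.
    by apply: eq_bigr => m _; apply: eq_bigr => k _; rewrite [in RHS]rmorphM /=; ring.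
  transitivity (\sum_m \sum_k u 0 m * Num.conj (u 0 k) *
      (e k m * (T m - T k) + W m k)%:C).
    rewrite exchange_big; apply: eq_bigr => m _.
    rewrite exchange_big; apply: eq_bigr => k _.
    by rewrite -mulr_sumr -sum_eM rmorph_sum.
  under eq_bigr do under eq_bigr do rewrite rmorphD mulrDr /=.
  under eq_bigr do rewrite big_split.
  rewrite big_split /= -[RHS]add0r; congr (_ + _).
  (* The sums with T_m and T_k are the conjugate of c, respectively c, times the same real number,
     so they cancel by [cJ]. *)
  have h1 : \sum_m \sum_k u 0 m * Num.conj (u 0 k) * (e k m * T m)%:C =
      \sum_m Num.conj c * (T m * x m ^+ 2)%:C.
    apply: eq_bigr => m _; rewrite rmorphM /= -uuE.
    transitivity (u 0 m * (T m)%:C * (Num.conj c * Num.conj (u 0 m))); last by ring.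
    rewrite -col mulr_sumr; apply: eq_bigr => k _; rewrite rmorphM /=; ring.
  have h2 : \sum_m \sum_k u 0 m * Num.conj (u 0 k) * (e k m * - T k)%:C =
      \sum_m c * (T m * x m ^+ 2)%:C.
    rewrite exchange_big; apply: eq_bigr => k _; rewrite rmorphM /= -uuE.
    transitivity (Num.conj (u 0 k) * (T k)%:C * (c * u 0 k)); last by ring.
    rewrite -row mulr_sumr; apply: eq_bigr => m _.
    rewrite (eC m k) rmorphM !rmorphN /=; ring.
  under eq_bigr do under eq_bigr do rewrite mulrDr rmorphD mulrDr /=.
  under eq_bigr do rewrite big_split.
  rewrite big_split /= h1 h2 -!mulr_sumr -mulrDl addrC cJ mul0r //.
have Wle : \sum_m \sum_k x m * x k * W m k <= 73 / 2 * X.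
  have -> : \sum_m \sum_k x m * x k * W m k = 2 * wform l s x +
      \sum_m x m ^+ 2 * (s m ^+ 2 * \sum_n s n ^+ 2 * K m n ^+ 2).
    have wE : wform l s x = \sum_m \sum_k x k * x m * (s k ^+ 3 * s m * K k m ^+ 2).
      exact: exchange_big.
    rewrite mulrDl mul1r {2}wE /wform -!big_split /=.
    apply: eq_bigr => m _; rewrite -big_split /=.
    rewrite /W; under eq_bigr do rewrite mulrDr.
    rewrite big_split /=; congr (_ + _).
      by apply: eq_bigr => k _; rewrite (cauchyker_anti l m k); ring.
    rewrite (bigD1 m) //= eqxx [X in _ + X]big1 ?addr0 // => k km.
    by rewrite eq_sym (negbTE km) mulr0.
  have : \sum_m x m ^+ 2 * (s m ^+ 2 * \sum_n s n ^+ 2 * K m n ^+ 2) <= 4 * X.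
    rewrite /X mulr_sumr; apply: ler_sum => m _; rewrite mulrC ler_wpM2r ?sqr_ge0 //.
    by rewrite mulrC -ler_pdivlMr ?exprn_gt0 // sum_sqr_cauchyker.
  have := wform_le s_gt0 sep x0; rewrite -/X; lra.
have : `|c| ^+ 2 * X%:C <= (73 / 2 * X)%:C.
  have cX0 : 0 <= `|c| ^+ 2 * X%:C by rewrite mulr_ge0 ?exprn_ge0 // lecR ltW.
  (* As W >= 0, the triangle inequality replaces u by its moduli x. *)
  rewrite -(ger0_norm cX0) key; apply: (@le_trans _ _ (\sum_m \sum_k x m * x k * W m k)%:C).
    rewrite rmorph_sum; apply: le_trans (ler_norm_sum _ _ _) _.
    apply: ler_sum => m _; rewrite rmorph_sum; apply: le_trans (ler_norm_sum _ _ _) _.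
    apply: ler_sum => k _; rewrite !normrM norm_conjC !xE !rmorphM /=.
    by rewrite [`|(W m k)%:C|]ger0_norm ?lecR.
  by rewrite lecR.
by rewrite rmorphM ler_pM2r // ltcR.
Qed.

End WeightedCauchyMatrix.

(** * From the eigenvalue bound to the inequality *)

Theorem corollary2 (R : realType) (N : nat) (hN : (2 <= N)%N)
    (lambda : 'I_N -> R) (hlambda : injective lambda) (a : 'I_N -> R[i]) :
  normc (\sum_(m < N) \sum_(n < N | m != n)
           a m * (a n)^* / (lambda m - lambda n)%:C)
  <= 2 * pi * \sum_(n < N) (normc (a n) ^+ 2 / delta lambda n).
Proof.
pose s n := Num.sqrt (delta lambda n).
have d0 n : 0 < delta lambda n.
  have [m mn ->] := delta_attained lambda n hN.
  by rewrite normr_gt0 subr_eq0 (inj_eq hlambda) eq_sym.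
have s0 n : 0 < s n by rewrite sqrtr_gt0.
have s2 n : s n ^+ 2 = delta lambda n by rewrite sqr_sqrtr ?ltW.
have sep m n : m != n -> s n ^+ 2 <= `|lambda n - lambda m|.
  by rewrite s2; exact: delta_le.
(* This scaling turns the form in a into the matrix form in u, and |u_n|^2 into |a_n|^2 /
   delta_n. *)
pose u := \row_n (a n / (s n)%:C).
have := @normalmx_form_le _ _ (cauchymx lambda s) (2 * pi)%:C (cauchymx_normal _ _) _ u.
have -> : (u *m cauchymx lambda s *m u^t*) 0 0 = \sum_(m < N) \sum_(n < N | m != n)
           a m * (a n)^* / (lambda m - lambda n)%:C.
  rewrite mxE; under eq_bigr do rewrite !mxE mulr_suml.
  rewrite exchange_big; apply: eq_bigr => m _.
  rewrite [RHS]big_mkcond; apply: eq_bigr => n _; rewrite !mxE.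
  have sm : (s m)%:C != 0 by rewrite (fmorph_eq0 (real_complex R)) gt_eqF.
  have sn : (s n)%:C != 0 by rewrite (fmorph_eq0 (real_complex R)) gt_eqF.
  rewrite /wcauchy; case: eqVneq => [->|mn] /=.
    by rewrite cauchyker_diag mulr0 rmorph0 mulr0 mul0r.
  have lmn : (lambda m)%:C - (lambda n)%:C != 0.
    by rewrite -rmorphB (fmorph_eq0 (real_complex R)) subr_eq0 (inj_eq hlambda).
  have csn : Num.conj (s n)%:C = (s n)%:C := conjc_real _.
  rewrite -[RHS]/(a m * Num.conj (a n) / (lambda m - lambda n)%:C) /cauchyker !rmorphM !fmorphV /= csn; field.
  by rewrite sm sn /= lmn.
have -> : \sum_i `|u 0 i| ^+ 2 = (\sum_(n < N) (normc (a n) ^+ 2 / delta lambda n))%:C.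
  rewrite rmorph_sum; apply: eq_bigr => n _.
  rewrite mxE normrM exprMn normfV -s2 rmorphM fmorphV !rmorphXn /= exprVn.
  by rewrite [`|(s n)%:C|]ger0_norm // ler0c ltW.
rewrite -rmorphM lecR; apply => w c w0 wc.
have pi2_ge0 : 0 <= 2 * pi :> R by rewrite mulr_ge0 ?pi_ge0.
(* After squaring, 73/2 <= 4 pi^2 remains to be compared. *)
rewrite -(@ler_pXn2r _ 2) ?nnegrE ?normr_ge0 ?ler0c //.
apply: le_trans (cauchymx_eigen_le s0 sep w0 wc) _.
by rewrite -rmorphXn /= lecR exprMn; have := pi_sqr_ge R; lra.
Qed.
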